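(* Let $\rho\in\mathbb{C}^{d\times d}$ be a quantum state and let $|v\rangle\sim\mathcal{D}(\rho)$. There exists a universal constant $C$ such that for all integers $h\ge 2$ and all Hermitian matrices $O\in\mathbb{C}^{d\times d}$, \[ \mathbb{E}_{v\sim\mathcal{D}(\rho)}\Big[\big(\langle v|O|v\rangle-\mathbb{E}_{v\sim\mathcal{D}(\rho)}[\langle v|O|v\rangle]\big)^h\Big]\le\Big(\frac{Ch\|O\|_{HS}}{d+1}\Big)^h. \]
   Context: $\mathcal{D}(\rho)$ is the outcome distribution of the uniform POVM applied to $\rho$: the distribution over unit vectors $|v\rangle\in\mathbb{C}^d$ with probability density $d\langle v|\rho|v\rangle\,\mathrm{d}v$, where $\mathrm{d}v$ is the unitarily invariant (Haar) probability measure on the complex unit sphere of $\mathbb{C}^d$. $\|O\|_{HS}=\sqrt{\operatorname{Tr}[O^\dagger O]}$. *)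

(* Defs.v *)
From HB Require Import structures.
From mathcomp Require Import all_boot all_order all_algebra.
From mathcomp Require Import sesquilinear spectral.
From mathcomp Require Import complex.
From mathcomp Require Import all_classical all_reals.
From mathcomp Require Import measure lebesgue_measure lebesgue_integral.

Unset Printing Implicit Defensive.

Import Order.TTheory GRing.Theory Num.Theory.
Local Open Scope ring_scope.
Local Open Scope classical_set_scope.

(** Technical: R[i] as a pointed type (needed to build measurable types). *)
HB.instance Definition _ (R : realType) := isPointed.Build R[i] 0.

(** The Borel sigma-algebra on C^d = R^(2d): generated by the real and
    imaginary parts of the coordinates. *)
Definition cvec_gen (R : realType) (d : nat) : set (set ('cV[R[i]]_d)) :=
  [set A | exists (i : 'I_d) (B : set R), measurable B /\
     (A = (fun v : 'cV[R[i]]_d => complex.Re (v i 0)) @^-1` B \/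
      A = (fun v : 'cV[R[i]]_d => complex.Im (v i 0)) @^-1` B)].


Definition CVec (R : realType) (d : nat) := g_sigma_algebraType (cvec_gen R d).

Definition braket (R : realType) (d : nat) (M : 'M[R[i]]_d) (v : 'cV[R[i]]_d) : R[i] :=
  ((v ^t* *m M *m v) 0 0)%sesqui.

Definition unit_sphere (R : realType) (d : nat) : set (CVec R d) :=
  [set v | ((v ^t* *m v) 0 0 = 1)%sesqui].

(** mu is a unitarily invariant probability measure on the unit sphere of C^d
    (i.e. the Haar measure, which is unique). *)
Definition haar_sphere_measure (R : realType) (d : nat)
    (mu : probability (CVec R d) R) : Prop :=
  mu (unit_sphere R d) = 1%E /\
  forall U : 'M[R[i]]_d, U \is unitarymx ->
    forall A : set (CVec R d), measurable A ->
      mu ((fun v : CVec R d => U *m v) @^-1` A) = mu A.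

Definition quantum_state (R : realType) (d : nat) (rho : 'M[R[i]]_d) : Prop :=
  (rho ^t* = rho)%sesqui /\
  (forall v : 'cV[R[i]]_d, 0 <= braket R d rho v) /\
  \tr rho = 1.

Definition hermitian_mx (R : realType) (d : nat) (O : 'M[R[i]]_d) : Prop :=
  (O ^t* = O)%sesqui.

Definition hs_norm (R : realType) (d : nat) (O : 'M[R[i]]_d) : R :=
  Num.sqrt (complex.Re (\tr ((O ^t* *m O)%sesqui))).

(** Expectation of f(v) for v ~ D(rho): the density of D(rho) with respect to
    the Haar measure mu is d <v|rho|v>. *)
Definition povm_expect (R : realType) (d : nat) (mu : probability (CVec R d) R)
    (rho : 'M[R[i]]_d) (f : 'cV[R[i]]_d -> R) : \bar R :=
  (\int[mu]_v (f v * (d%:R * complex.Re (braket R d rho v)))%:E)%E.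

(* Main.v *)
Require Import Defs.
From HB Require Import structures.
From mathcomp Require Import all_boot all_order all_algebra.
From mathcomp Require Import sesquilinear spectral complex.
From mathcomp Require Import all_classical all_reals.
From mathcomp Require Import topology normedtype measurable_realfun.
From mathcomp Require Import measure lebesgue_measure lebesgue_integral.
From mathcomp Require Import zify ring lra.

(** Write [<A> = <v|A|v>], [X = <O>], and [E] for the Haar mean.  The moments of
    [X] are never computed from a formula for the Haar measure; they come from
    invariance alone.  For a Hermitian involution [K] the matrix [1 - i t K] is
    [sqrt (1 + t^2)] times a unitary, so [E[<A> X^n]] evaluated at [(1 - i t K) v]
    is [(1 + t^2)^(n+1) E[<A> X^n]].  Both sides are polynomials in [t], and the
    coefficient of [t] gives
      [E[<[A, T]> X^n + n <A> <[O, T]> X^(n-1)] = 0]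
    for [T = K], then (reflections and polarization) for every rank-one [T].
    Summing over [A = E_jk], [T = E_kj B] yields
      [(d + n) E[<B> X^n] = tr B E[X^n] + n E[<B O> X^(n-1)]].
    After normalisation by binomial coefficients this is Newton's recursion for
    complete homogeneous symmetric polynomials; when [tr O = 0] and
    [s = |O|_HS] it gives [|E[X^n]| <= s^n / C(d+n-1, n)] and
    [|d E[<rho> X^n]| <= (n + 1) s^n / C(d+n, n) <= (n + 1) (n s / (d + 1))^n].
    Even central moments follow by convexity, and odd ones from
    [2 t y^h <= y^(h+1) + t^2 y^(h-1)]. *)

Import Order.TTheory GRing.Theory Num.Theory.
Import numFieldNormedType.Exports.
Local Open Scope ring_scope.
Local Open Scope classical_set_scope.

(** * Bounded measurable functions on the sphere *)

Section Tame.
Context (R : realType) (d : nat).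
Implicit Types (f g : CVec R d -> R) (v : CVec R d).

(** The bound is asked on the sphere only: coordinates are unbounded on [C^d], but [mu] is
    concentrated on the sphere. *)
Definition tame f := measurable_fun [set: CVec R d] f /\
  exists M : R, forall v, unit_sphere R d v -> `|f v| <= M.

Lemma tame_cst (c : R) : tame (fun=> c).
Proof. by split; [exact: measurable_cst | exists `|c|]. Qed.

Lemma tameD f g : tame f -> tame g -> tame (fun v => f v + g v).
Proof.
move=> [mf [M hM]] [mg [N hN]]; split; first exact: measurable_funD.
by exists (M + N) => v Sv; rewrite (le_trans (ler_normD _ _))// lerD ?hM ?hN.
Qed.

Lemma tameN f : tame f -> tame (fun v => - f v).
Proof.
move=> [mf [M hM]]; split; first exact: measurableT_comp.
by exists M => v Sv; rewrite normrN hM.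
Qed.

Lemma tameM f g : tame f -> tame g -> tame (fun v => f v * g v).
Proof.
move=> [mf [M hM]] [mg [N hN]]; split; first exact: measurable_funM.
by exists (M * N) => v Sv; rewrite normrM ler_pM ?hM ?hN.
Qed.

Lemma tameX f n : tame f -> tame (fun v => f v ^+ n).
Proof.
move=> hf; elim: n => [|n ih]; first exact: tame_cst.
by under eq_fun do rewrite exprS; exact: tameM.
Qed.

(** Exhibits the sphere as a level set of a real function of the coordinates, which yields its
    measurability and the bounds on coordinates. *)
Lemma unit_sphereE v :
  unit_sphere R d v <-> \sum_i (complex.Re (v i 0) ^+ 2 + complex.Im (v i 0) ^+ 2) = 1.
Proof.
rewrite /unit_sphere /= mxE.
have -> : \sum_j ((v ^t*)%sesqui 0 j * v j 0) =
   (\sum_i (complex.Re (v i 0) ^+ 2 + complex.Im (v i 0) ^+ 2))%:C%C.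
  rewrite rmorph_sum; apply: eq_bigr => i _.
  by rewrite [RHS]add_Re2_Im2 normCK mulrC !mxE.
by split => [[]|->].
Qed.

Lemma measurable_Re_coord i : measurable_fun [set: CVec R d] (fun v => complex.Re (v i 0)).
Proof.
move=> _ B mB; rewrite setTI; apply: sub_sigma_algebra.
by exists i, B; split => //; left.
Qed.

Lemma measurable_Im_coord i : measurable_fun [set: CVec R d] (fun v => complex.Im (v i 0)).
Proof.
move=> _ B mB; rewrite setTI; apply: sub_sigma_algebra.
by exists i, B; split => //; right.
Qed.

Lemma unit_sphere_coord v i : unit_sphere R d v ->
  complex.Re (v i 0) ^+ 2 + complex.Im (v i 0) ^+ 2 <= 1.
Proof.
move=> /unit_sphereE <-; rewrite [leRHS](bigD1 i)//= lerDl sumr_ge0 // => j _.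
by rewrite addr_ge0 ?sqr_ge0.
Qed.

Lemma tame_Re_coord i : tame (fun v => complex.Re (v i 0)).
Proof.
split; first exact: measurable_Re_coord.
exists 1 => v /(unit_sphere_coord v i) h; rewrite -(@expr_le1 _ 2)// real_normK ?num_real//.
by apply: le_trans h; rewrite lerDl sqr_ge0.
Qed.

Lemma tame_Im_coord i : tame (fun v => complex.Im (v i 0)).
Proof.
split; first exact: measurable_Im_coord.
exists 1 => v /(unit_sphere_coord v i) h; rewrite -(@expr_le1 _ 2)// real_normK ?num_real//.
by apply: le_trans h; rewrite lerDr sqr_ge0.
Qed.

Lemma measurable_unit_sphere : measurable (unit_sphere R d : set (CVec R d)).
Proof.
have -> : unit_sphere R d = setT `&` (fun v : CVec R d =>
    \sum_i (complex.Re (v i 0) ^+ 2 + complex.Im (v i 0) ^+ 2)) @^-1` [set 1].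
  by rewrite setTI; apply/seteqP; split => v /unit_sphereE.
have mf : measurable_fun [set: CVec R d] (fun v : CVec R d =>
    \sum_i (complex.Re (v i 0) ^+ 2 + complex.Im (v i 0) ^+ 2)).
  apply: measurable_sum => i; apply: measurable_funD; apply: measurable_funX.
    exact: measurable_Re_coord.
  exact: measurable_Im_coord.
exact: mf.
Qed.

Definition ctame (f : CVec R d -> R[i]) :=
  tame (fun v => complex.Re (f v)) /\ tame (fun v => complex.Im (f v)).

Lemma ctame_cst (c : R[i]) : ctame (fun=> c).
Proof. by split; exact: tame_cst. Qed.

Lemma ctameD (f g : CVec R d -> R[i]) : ctame f -> ctame g -> ctame (fun v => f v + g v).
Proof.
move=> [f1 f2] [g1 g2]; split; under eq_fun do rewrite raddfD /=; exact: tameD.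
Qed.

Lemma ReM (x y : R[i]) : complex.Re (x * y) =
  complex.Re x * complex.Re y - complex.Im x * complex.Im y.
Proof. by case: x y => [a b] [a' b']. Qed.

Lemma ImM (x y : R[i]) : complex.Im (x * y) =
  complex.Re x * complex.Im y + complex.Im x * complex.Re y.
Proof. by case: x y => [a b] [a' b']. Qed.

Lemma ctameM (f g : CVec R d -> R[i]) : ctame f -> ctame g -> ctame (fun v => f v * g v).
Proof.
move=> [f1 f2] [g1 g2]; split.
  under eq_fun do rewrite ReM; apply: tameD; first exact: tameM.
  by apply: tameN; exact: tameM.
by under eq_fun do rewrite ImM; apply: tameD; exact: tameM.
Qed.

Lemma ctameX (f : CVec R d -> R[i]) n : ctame f -> ctame (fun v => f v ^+ n).
Proof.
move=> hf; elim: n => [|n ih]; first exact: ctame_cst.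
by under eq_fun do rewrite exprS; exact: ctameM.
Qed.

Lemma ctame_sum (I : finType) (F : I -> CVec R d -> R[i]) :
  (forall i, ctame (F i)) -> ctame (fun v => \sum_i F i v).
Proof.
move=> hF; elim: (index_enum I) => [|i s ih].
  by under eq_fun do rewrite big_nil; exact: ctame_cst.
by under eq_fun do rewrite big_cons; exact: ctameD.
Qed.

Lemma ctame_coord i : ctame (fun v => v i 0).
Proof. by split; [exact: tame_Re_coord | exact: tame_Im_coord]. Qed.

Lemma ctame_conj (f : CVec R d -> R[i]) : ctame f -> ctame (fun v => (f v)^*).
Proof.
move=> [f1 f2]; split.
  rewrite (_ : (fun v => _) = fun v => complex.Re (f v))//.
  by apply/funext => v; case: (f v).
rewrite (_ : (fun v => _) = fun v => - complex.Im (f v)); first exact: tameN.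
by apply/funext => v; case: (f v).
Qed.

Lemma braketE (M : 'M[R[i]]_d) v :
  braket R d M v = \sum_i \sum_j (v i 0)^* * M i j * v j 0.
Proof.
rewrite /braket mxE exchange_big /=; apply: eq_bigr => j _.
by rewrite !mxE mulr_suml; apply: eq_bigr => i _; rewrite !mxE.
Qed.

Lemma ctame_braket (M : 'M[R[i]]_d) : ctame (fun v => braket R d M v).
Proof.
under eq_fun do rewrite braketE.
apply: ctame_sum => i; apply: ctame_sum => j.
apply: ctameM; last exact: ctame_coord.
apply: ctameM; last exact: ctame_cst.
by apply: ctame_conj; exact: ctame_coord.
Qed.

(** It suffices to test the generators of the sigma-algebra, that is, the real and imaginary parts
    of the coordinates of [U v], which are sums of tame functions. *)
Lemma measurable_mulmx (U : 'M[R[i]]_d) :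
  measurable_fun [set: CVec R d] (fun v : CVec R d => (U *m v : CVec R d)).
Proof.
have cU i : ctame (fun v => (U *m v) i 0).
  under eq_fun do rewrite mxE; apply: ctame_sum => j.
  by apply: ctameM; [exact: ctame_cst | exact: ctame_coord].
apply: (@measurability _ _ (CVec R d) (CVec R d) setT _ (cvec_gen R d)) => //.
move=> _ [_ [i [B [mB [|]->]]] <-].
  by have [[m _] _] := cU i; exact: m.
by have [_ [m _]] := cU i; exact: m.
Qed.

End Tame.

(** * Integration over the sphere and unitary invariance *)

Section Expectation.
Context (R : realType) (d : nat) (mu : probability (CVec R d) R).
Hypothesis muH : haar_sphere_measure R d mu.
Implicit Types (f g : CVec R d -> R) (v : CVec R d).

Local Notation S := (unit_sphere R d).

Definition sphere_mean f : R := \int[mu]_(v in S) f v.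

Lemma tame_integrable f : tame R d f -> mu.-integrable S (EFin \o f).
Proof.
move=> [mf [M hM]]; apply: measurable_bounded_integrable.
- exact: measurable_unit_sphere.
- by apply: (le_lt_trans (probability_le1 _ (measurable_unit_sphere R d))); rewrite ltry.
- exact: measurable_funTS.
- exists M; split; first by rewrite num_real.
  by move=> x Mx v Sv; apply: (le_trans (hM v Sv)); exact: ltW.
Qed.

(** The complement of the sphere is [mu]-null, so the integral over the whole space in [povm_expect]
    can be replaced by one over a set where tame functions are bounded. *)
Lemma integral_sphere f : tame R d f ->
  (\int[mu]_v (f v)%:E = (sphere_mean f)%:E)%E.
Proof.
move=> tf; rewrite /sphere_mean /Rintegral fineK; last first.
  by apply: integrable_fin_num; [exact: measurable_unit_sphere|exact: tame_integrable tf].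
rewrite [RHS]integral_mkcond; apply: ae_eq_integral => //.
- by apply/measurable_EFinP; exact: tf.1.
- apply: (iffLR (measurable_restrictT _ (measurable_unit_sphere R d))).
  apply: measurable_funTS.
  by apply/measurable_EFinP; exact: tf.1.
- exists (~` S); split.
  + exact: measurableC (measurable_unit_sphere R d).
  + apply: (etrans (probability_setC mu (measurable_unit_sphere R d))).
    by apply: (etrans (congr1 (fun x => 1 - x)%E muH.1)); rewrite subee.
  + by move=> v /= h Sv; apply: h => _; rewrite /patch mem_set.
Qed.

Lemma sphere_mean_cst c : sphere_mean (fun=> c) = c.
Proof.
rewrite /sphere_mean Rintegral_cst; last exact: measurable_unit_sphere.
by rewrite (_ : fine _ = 1) ?mulr1//; exact: (congr1 fine muH.1).
Qed.

Lemma sphere_meanD f g : tame R d f -> tame R d g ->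
  sphere_mean (fun v => f v + g v) = sphere_mean f + sphere_mean g.
Proof.
move=> tf tg; apply: RintegralD (tame_integrable _ tf) (tame_integrable _ tg).
exact: measurable_unit_sphere.
Qed.

Lemma sphere_meanZ c f : tame R d f ->
  sphere_mean (fun v => c * f v) = c * sphere_mean f.
Proof.
move=> tf; apply: RintegralZl (tame_integrable _ tf).
exact: measurable_unit_sphere.
Qed.

Lemma eq_sphere_mean f g : (forall v, S v -> f v = g v) ->
  sphere_mean f = sphere_mean g.
Proof. by move=> fg; apply: eq_Rintegral => v /set_mem; exact: fg. Qed.

Lemma le_sphere_mean f g : tame R d f -> tame R d g ->
  (forall v, S v -> f v <= g v) -> sphere_mean f <= sphere_mean g.
Proof.
move=> tf tg; apply: le_Rintegral (tame_integrable _ tf) (tame_integrable _ tg).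
exact: measurable_unit_sphere.
Qed.

Lemma unit_sphere_unitary (U : 'M[R[i]]_d) v : U \is unitarymx ->
  S (U *m v) <-> S v.
Proof.
move=> /unitarymxP hU; rewrite /unit_sphere /=.
rewrite trmx_mul map_mxM -mulmxA (mulmxA _ U) (_ : _ *m U = 1%:M) ?mul1mx//.
by apply: mulmx1C.
Qed.

(** Change of variables: the pushforward of [mu] along [U] is [mu], and the preimage of the sphere
    is the sphere. *)
Lemma sphere_mean_unitary f (U : 'M[R[i]]_d) : tame R d f -> U \is unitarymx ->
  sphere_mean (fun v => f (U *m v)) = sphere_mean f.
Proof.
move=> tf hU; rewrite /sphere_mean /Rintegral; congr fine.
have SU : (fun v : CVec R d => (U *m v : CVec R d)) @^-1` S = S.
  by apply/seteqP; split => v /=; move/unit_sphere_unitary; apply.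
have mU := measurable_mulmx R d U.
have tfU : tame R d (fun v => f (U *m v)).
  split; first exact: measurableT_comp tf.1 mU.
  have [_ [M hM]] := tf; exists M => v Sv; apply: hM.
  exact/unit_sphere_unitary.
transitivity (\int[pushforward mu (fun v : CVec R d => (U *m v : CVec R d))]_(v in S) (f v)%:E)%E.
  rewrite (integral_pushforward mU).
  - by rewrite SU.
  - by apply/measurable_EFinP; exact: tf.1.
  - by rewrite SU; exact: tame_integrable tfU.
  - exact: measurable_unit_sphere.
by apply: eq_measure_integral => A mA _; exact: muH.2.
Qed.

(** Complex values are unavoidable: the recursion uses brackets of non-Hermitian matrices such as
    [E_jk] and [B O]. *)
Definition csphere_mean (f : CVec R d -> R[i]) : R[i] :=
  (sphere_mean (fun v => complex.Re (f v)) +i* sphere_mean (fun v => complex.Im (f v)))%C.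

Implicit Types F G : CVec R d -> R[i].

Lemma csphere_mean_cst c : csphere_mean (fun=> c) = c.
Proof. by rewrite /csphere_mean !sphere_mean_cst; case: c. Qed.

Lemma csphere_meanD F G : ctame R d F -> ctame R d G ->
  csphere_mean (fun v => F v + G v) = csphere_mean F + csphere_mean G.
Proof.
move=> [F1 F2] [G1 G2]; rewrite /csphere_mean.
under [X in (X +i* _)%C]eq_sphere_mean do rewrite raddfD.
under [X in (_ +i* X)%C]eq_sphere_mean do rewrite raddfD.
by rewrite !sphere_meanD.
Qed.

Lemma csphere_meanZ c F : ctame R d F ->
  csphere_mean (fun v => c * F v) = c * csphere_mean F.
Proof.
move=> [F1 F2]; rewrite /csphere_mean; under [X in (X +i* _)%C]eq_sphere_mean do rewrite ReM -mulNr.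
under [X in (_ +i* X)%C]eq_sphere_mean do rewrite ImM.
rewrite !sphere_meanD ?sphere_meanZ //; try by apply: tameM => //; exact: tame_cst.
by case: c => a b; rewrite mulNr.
Qed.

Lemma csphere_mean_sum (I : finType) (F : I -> CVec R d -> R[i]) :
  (forall i, ctame R d (F i)) ->
  csphere_mean (fun v => \sum_i F i v) = \sum_i csphere_mean (F i).
Proof.
move=> hF; suff [] : csphere_mean (fun v => \sum_i F i v) = \sum_i csphere_mean (F i)
  /\ ctame R d (fun v => \sum_i F i v) by [].
elim: (index_enum I) => [|i s [ih1 ih2]].
  rewrite big_nil -[RHS](csphere_mean_cst 0); under eq_fun do rewrite big_nil.
  by split => //; exact: ctame_cst.
rewrite big_cons -ih1; under eq_fun do rewrite big_cons.
by split; [exact: csphere_meanD | exact: ctameD].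
Qed.

Lemma eq_csphere_mean F G : (forall v, S v -> F v = G v) ->
  csphere_mean F = csphere_mean G.
Proof.
by move=> FG; congr Complex; apply: eq_sphere_mean => v /FG ->.
Qed.

Lemma csphere_mean_unitary F (U : 'M[R[i]]_d) : ctame R d F -> U \is unitarymx ->
  csphere_mean (fun v => F (U *m v)) = csphere_mean F.
Proof.
move=> [F1 F2] hU; congr Complex.
  exact: (sphere_mean_unitary (fun v => complex.Re (F v))).
exact: (sphere_mean_unitary (fun v => complex.Im (F v))).
Qed.

End Expectation.

(** * Quadratic forms *)

Section Braket.
Local Open Scope sesquilinear_scope.
Context (R : realType) (d : nat).
Implicit Types (M N : 'M[R[i]]_d) (v : 'cV[R[i]]_d).

Lemma adjmxM m n p (M : 'M[R[i]]_(m, n)) (N : 'M[R[i]]_(n, p)) :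
  (M *m N) ^t* = N ^t* *m M ^t*.
Proof. by rewrite trmx_mul map_mxM. Qed.

Lemma adjmxZ m n c (M : 'M[R[i]]_(m, n)) : (c *: M) ^t* = c^* *: M ^t*.
Proof. by apply/matrixP => i j; rewrite !mxE rmorphM. Qed.

Lemma adjmxD m n (M N : 'M[R[i]]_(m, n)) : (M + N) ^t* = M ^t* + N ^t*.
Proof. by apply/matrixP => i j; rewrite !mxE rmorphD. Qed.

Lemma adjmxN m n (M : 'M[R[i]]_(m, n)) : (- M) ^t* = - M ^t*.
Proof. by apply/matrixP => i j; rewrite !mxE rmorphN. Qed.

Lemma adjmx1 : (1%:M : 'M[R[i]]_d) ^t* = 1%:M.
Proof. by rewrite trmx1 map_mx1. Qed.

Lemma braketD M N v : braket R d (M + N) v = braket R d M v + braket R d N v.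
Proof. by rewrite /braket mulmxDr mulmxDl mxE. Qed.

Lemma braketZ c M v : braket R d (c *: M) v = c * braket R d M v.
Proof. by rewrite /braket -scalemxAr -scalemxAl mxE. Qed.

Lemma braketN M v : braket R d (- M) v = - braket R d M v.
Proof. by rewrite -scaleN1r braketZ mulN1r. Qed.

Lemma braketB M N v : braket R d (M - N) v = braket R d M v - braket R d N v.
Proof. by rewrite braketD braketN. Qed.

Lemma braket1 v : unit_sphere R d v -> braket R d 1%:M v = 1.
Proof. by rewrite /unit_sphere /= /braket mulmx1. Qed.

Lemma braket_mulmx M (U : 'M[R[i]]_d) v :
  braket R d M (U *m v) = braket R d (U ^t* *m M *m U) v.
Proof. by rewrite /braket adjmxM !mulmxA. Qed.

Lemma braket_delta M N j k v : braket R d (M *m delta_mx j k *m N) v =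
  (v ^t* *m M) 0 j * (N *m v) k 0.
Proof.
rewrite /braket !mulmxA -(mulmxA _ N) mxE (bigD1 k)//= big1 => [|l lk].
  rewrite addr0; congr (_ * _); rewrite mxE (bigD1 j)//= big1 => [|l lj].
    by rewrite !mxE !eqxx mulr1 addr0.
  by rewrite !mxE (negbTE lj) mulr0.
rewrite mxE big1 ?mul0r// => l' _.
by rewrite !mxE (negbTE lk) andbF mulr0.
Qed.

Lemma braket_herm_real M v : hermitian_mx R d M ->
  braket R d M v = (complex.Re (braket R d M v))%:C%C.
Proof.
move=> hM; rewrite RRe_real//; apply/CrealP.
rewrite /braket -[in RHS]hM; set x := v ^t* *m M *m v.
have -> : (x 0 0)^* = (x ^t*) 0 0 by rewrite !mxE.
by rewrite /x !adjmxM trmxCK mulmxA.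
Qed.

End Braket.

(** * Means of polynomial-valued functions *)

Section PolynomialMean.
Context (R : realType) (d : nat) (mu : probability (CVec R d) R).
Hypothesis muH : haar_sphere_measure R d mu.
Implicit Types p q : CVec R d -> {poly R[i]}.

(** The degree bound is uniform in [v], so that the coefficientwise mean is again a polynomial. *)
Definition ptame p := (exists N, forall v, (size (p v) <= N)%N) /\
  forall i, ctame R d (fun v => (p v)`_i).

Lemma ptameM p q : ptame p -> ptame q -> ptame (fun v => p v * q v).
Proof.
move=> [[N hN] tp] [[N' hN'] tq]; split.
  exists (N + N')%N => v; apply: leq_trans (size_polyMleq _ _) _.
  by apply: leq_trans (leq_pred _) _; exact: leq_add.
move=> i; under eq_fun do rewrite coefM.
by apply: ctame_sum => j; exact: ctameM.
Qed.

Lemma ptameX p n : ptame p -> ptame (fun v => p v ^+ n).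
Proof.
move=> tp; elim: n => [|n ih].
  split; first by exists 1%N => v; rewrite expr0 size_poly1.
  by move=> i; exact: (ctame_cst R d (1 : {poly R[i]})`_i).
by under eq_fun do rewrite exprS; exact: ptameM.
Qed.

(** In characteristic zero the naturals supply more distinct roots of [P - Q] than its degree
    allows. *)
Lemma poly_eq_nat (F : numFieldType) (P Q : {poly F}) :
  (forall k : nat, P.[k%:R] = Q.[k%:R]) -> P = Q.
Proof.
move=> PQ; apply/eqP; rewrite -subr_eq0; apply/negPn/negP => nz.
pose s := [seq (k%:R : F) | k <- iota 0 (size (P - Q))].
have /max_poly_roots : P - Q != 0 by [].
move=> /(_ s); rewrite size_map size_iota ltnn; suff -> : all (root (P - Q)) s.
  suff -> : uniq s by move=> /(_ isT isT).
  by rewrite map_inj_uniq ?iota_uniq//; exact: mulrIn (oner_neq0 _).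
by apply/allP => x /mapP[k _ ->]; rewrite rootE !hornerE PQ subrr.
Qed.

Lemma coef1_deriv (F : nzRingType) (P : {poly F}) : P`_1 = P^`().[0].
Proof. by rewrite horner_coef0 coef_deriv. Qed.

(** The coefficientwise mean of [p] agrees with [c (1 + X^2)^m] at all naturals, hence equals it,
    and an even polynomial has no linear term. *)
Lemma mean_coef1_eq0 p m c : ptame p ->
  (forall k : nat, csphere_mean R d mu (fun v => (p v).[k%:R]) =
     (1 + k%:R ^+ 2) ^+ m * c) ->
  csphere_mean R d mu (fun v => (p v)`_1) = 0.
Proof.
move=> [[N hN] tp] hk.
(* [N.+2] keeps index 1 in range even when [N = 0], so that the linear coefficient of [q] is always
   the wanted mean. *)
pose q := \poly_(i < N.+2) csphere_mean R d mu (fun v => (p v)`_i).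
have qE : q = c *: (1 + 'X^2) ^+ m.
  apply: poly_eq_nat => // k; rewrite !hornerE -[RHS]mulrC -hk.
  rewrite /q horner_poly; under [RHS]eq_csphere_mean => v _.
    rewrite (horner_coef_wide _ (leq_trans (hN v) (leqW (leqnSn _)))).
    under eq_bigr do rewrite mulrC.
    over.
  rewrite csphere_mean_sum //; last first.
    by move=> i; apply: ctameM => //; exact: ctame_cst.
  by apply: eq_bigr => i _; rewrite csphere_meanZ// mulrC.
have <- : q`_1 = csphere_mean R d mu (fun v => (p v)`_1) by rewrite coef_poly.
rewrite qE coef1_deriv derivZ deriv_exp derivD derivXn -polyC1 derivC.
by rewrite !hornerE hornerMn hornerM hornerMn hornerX mul0rn mul0r mul0rn mulr0.
Qed.

End PolynomialMean.

(** * Infinitesimal unitary invariance *)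

Section CommutatorMean.
Local Open Scope sesquilinear_scope.
Context (R : realType) (d : nat) (mu : probability (CVec R d) R).
Hypothesis muH : haar_sphere_measure R d mu.
Implicit Types (A O K T B : 'M[R[i]]_d) (v : CVec R d).

Local Notation "<[ M ]> v" := (braket R d M v) (at level 10, v at level 9, format "<[ M ]>  v").
Local Notation mean := (csphere_mean R d mu).

(* The first-order variation of [<A> <O>^n] under [v |-> v + eps T v] for a
   skew-Hermitian [T], extended C-linearly to all [T]. *)
Definition comm_integrand A O n T v : R[i] :=
  (<[A *m T]> v - <[T *m A]> v) * <[O]> v ^+ n +
  n%:R * (<[A]> v * (<[O *m T]> v - <[T *m O]> v) * <[O]> v ^+ n.-1).

Let comm_integrandD_subproof (F : comPzRingType) (a a' b b' c c' e e' x y z m : F) :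
  (a + a' - (b + b')) * x + m * (y * (c + c' - (e + e')) * z) =
  ((a - b) * x + m * (y * (c - e) * z)) + ((a' - b') * x + m * (y * (c' - e') * z)).
Proof. by ring. Qed.

Let comm_integrandZ_subproof (F : comPzRingType) (a b c e x y z m t : F) :
  (t * a - t * b) * x + m * (y * (t * c - t * e) * z) =
  t * ((a - b) * x + m * (y * (c - e) * z)).
Proof. by ring. Qed.

Lemma ctame_comm_integrand A O n T : ctame R d (comm_integrand A O n T).
Proof.
have tb M := ctame_braket R d M.
have tc M : ctame R d (fun v => <[M *m T]> v - <[T *m M]> v).
  by under eq_fun do rewrite -braketB.
apply: ctameD; first by apply: ctameM => //; exact: ctameX.
apply: ctameM; first exact: ctame_cst.
by apply: ctameM; [exact: ctameM | exact: ctameX].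
Qed.

Definition comm_mean A O n T := mean (comm_integrand A O n T).

Lemma comm_meanD A O n T T' :
  comm_mean A O n (T + T') = comm_mean A O n T + comm_mean A O n T'.
Proof.
rewrite /comm_mean -csphere_meanD//; try exact: ctame_comm_integrand.
apply: eq_csphere_mean => v _; rewrite /comm_integrand.
rewrite !mulmxDr !mulmxDl !braketD.
exact: comm_integrandD_subproof.
Qed.

Lemma comm_meanZ A O n c T : comm_mean A O n (c *: T) = c * comm_mean A O n T.
Proof.
rewrite /comm_mean -csphere_meanZ//; last exact: ctame_comm_integrand.
apply: eq_csphere_mean => v _; rewrite /comm_integrand.
rewrite -!scalemxAr -!scalemxAl !braketZ.
exact: comm_integrandZ_subproof.
Qed.

Lemma comm_mean1 A O n : comm_mean A O n 1%:M = 0.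
Proof.
rewrite -[RHS](csphere_mean_cst R d mu muH 0); apply: eq_csphere_mean => v _.
rewrite /comm_integrand !mulmx1 !mul1mx !subrr.
by rewrite mul0r mulr0 mul0r mulr0 addr0.
Qed.

(** Each of the [n + 1] brackets is quadratic in [v], so rescaling to a unitary extracts one factor
    [1 + k^2] from each. Natural values of the parameter suffice for [poly_eq_nat]. *)
Lemma mean_cayley A O K n (k : nat) : K ^t* = K -> K *m K = 1%:M ->
  mean (fun v => <[A]> ((1%:M - ('i * k%:R) *: K) *m v) *
     <[O]> ((1%:M - ('i * k%:R) *: K) *m v) ^+ n) =
  (1 + k%:R ^+ 2) ^+ n.+1 * mean (fun v => <[A]> v * <[O]> v ^+ n).
Proof.
move=> Kh K2; set V := 1%:M - _.
have k1_gt0 : 0 < 1 + k%:R ^+ 2 :> R[i] by rewrite ltr_pwDl// exprn_ge0// ler0n.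
pose c : R[i] := sqrtC (1 + k%:R ^+ 2).
have c2 : c ^+ 2 = 1 + k%:R ^+ 2 by rewrite sqrtCK.
have c_gt0 : 0 < c by rewrite sqrtC_gt0.
have cc : c^* = c by apply: CrealP; rewrite ger0_real ?ltW.
have cVc : (c^-1)^* = c^-1 by apply: CrealP; rewrite ger0_real// invr_ge0 ltW.
have VV : V *m V ^t* = (c ^+ 2)%:M.
  have -> : V ^t* = 1%:M + ('i * k%:R) *: K.
    rewrite /V adjmxD adjmxN adjmxZ adjmx1 Kh.
    by rewrite rmorphM /= conjCi conjC_nat mulNr scaleNr opprK.
  rewrite /V mulmxDr !mulmxBl !mul1mx mulmx1 -scalemxAl -scalemxAr scalerA K2.
  rewrite addrA subrK -[X in X - _]scale1r -scalerBl scalemx1; congr (_%:M).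
  by rewrite c2 mulrACA -!expr2 sqrCi mulN1r opprK.
pose U := c^-1 *: V.
have hU : U \is unitarymx.
  apply/unitarymxP; rewrite /U adjmxZ -scalemxAl -scalemxAr VV.
  rewrite cVc scalerA -scalemx1 scalerA -expr2 -exprMn mulVf ?expr1n ?scale1r//.
  by rewrite gt_eqF.
have VE v : V *m v = c *: (U *m v).
  by rewrite /U -scalemxAl scalerA divff ?scale1r// gt_eqF.
have bc M v : <[M]> (c *: v) = c ^+ 2 * <[M]> v.
  rewrite /braket adjmxZ cc -!scalemxAl -scalemxAr !mxE.
  by rewrite mulrA expr2.
have tb M := ctame_braket R d M.
under eq_csphere_mean => v _ do rewrite VE !bc exprMn mulrACA -exprS c2.
have tAO : ctame R d (fun v => <[A]> v * <[O]> v ^+ n).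
  by apply: ctameM => //; exact: ctameX.
rewrite csphere_meanZ.
  by rewrite (csphere_mean_unitary R d mu muH _ U tAO hU).
under eq_fun do rewrite !braket_mulmx.
by apply: ctameM => //; exact: ctameX.
Qed.

Lemma mulmx_cayley (F : comPzRingType) m (M K : 'M[F]_m) z :
  (1%:M + z *: K) *m M *m (1%:M - z *: K) =
  M + - z *: (M *m K) + z *: (K *m M) + - z ^+ 2 *: (K *m M *m K).
Proof.
rewrite mulmxDl mul1mx mulmxBr mulmx1 mulmxDl -!scalemxAl -!scalemxAr scalerA.
by rewrite opprD -expr2 -!scaleNr addrACA addrA.
Qed.

Let cayley_poly_subproof (F : comPzRingType) (i k a b c e : F) : i ^+ 2 = -1 ->
  ((0 * k + e) * k + - i * (b - c)) * k + a =
  a + - (i * k) * b + i * k * c + - (i * k) ^+ 2 * e.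
Proof. by move=> i2; rewrite exprMn i2; ring. Qed.

Lemma coef1_mulX (F : comNzRingType) (P Q : {poly F}) n : (P * Q ^+ n)`_1 =
  P`_1 * Q`_0 ^+ n + n%:R * (P`_0 * Q`_1 * Q`_0 ^+ n.-1).
Proof.
rewrite coef1_deriv derivM deriv_exp hornerD !hornerM hornerMn hornerM !horner_exp.
by rewrite -!coef1_deriv !horner_coef0 -mulr_natl mulrCA !mulrA.
Qed.

Let comm_coef1_subproof (F : comPzRingType) (a b c e x y z m t : F) :
  t * ((a - b) * x + m * (y * (c - e) * z)) =
  t * (a - b) * x + m * (y * (t * (c - e)) * z).
Proof. by ring. Qed.

Lemma comm_mean_involution A O K n : K ^t* = K -> K *m K = 1%:M ->
  comm_mean A O n K = 0.
Proof.
move=> Kh K2.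
(* The coefficients in [t] of [(1 + i t K) M (1 - i t K)], bracketed at [v]. *)
pose p M v := Poly [:: <[M]> v; - 'i * (<[M *m K]> v - <[K *m M]> v); <[K *m M *m K]> v].
have tb M := ctame_braket R d M.
have tp M : ptame R d (p M).
  split; first by exists 3%N => v; apply: leq_trans (size_Poly _) _.
  move=> [|[|[|i]]]; under eq_fun do rewrite coef_Poly /= ?nth_nil //=.
  - exact: tb.
  - apply: ctameM; first exact: ctame_cst.
    by under eq_fun do rewrite -braketB.
  - exact: tb.
  - exact: ctame_cst.
have p0 M v : (p M v)`_0 = <[M]> v by rewrite coef_Poly.
have p1 M v : (p M v)`_1 = - 'i * (<[M *m K]> v - <[K *m M]> v) by rewrite coef_Poly.
have pE M (k : nat) v : (p M v).[k%:R] = <[M]> ((1%:M - ('i * k%:R) *: K) *m v).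
  rewrite horner_Poly /= braket_mulmx.
  have -> : (1%:M - ('i * k%:R) *: K) ^t* = 1%:M + ('i * k%:R) *: K :> 'M[R[i]]_d.
    rewrite adjmxD adjmxN adjmxZ adjmx1 Kh.
    by rewrite rmorphM /= conjCi conjC_nat mulNr scaleNr opprK.
  rewrite mulmx_cayley 3!braketD 3!braketZ.
  exact: cayley_poly_subproof (sqrCi _).
have := mean_coef1_eq0 R d mu muH (fun v => p A v * p O v ^+ n) n.+1
  (mean (fun v => <[A]> v * <[O]> v ^+ n)).
move=> /(_ (ptameM _ _ _ _ (tp A) (ptameX _ _ _ n (tp O)))) H.
have {}H : mean (fun v => (p A v * p O v ^+ n)`_1) = 0.
  apply: H => k; rewrite -(mean_cayley A O K)//; apply: eq_csphere_mean => v _.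
  by rewrite hornerM horner_exp !pE.
(* By the product rule [coef1_mulX], the linear coefficient is [- i] times [comm_integrand]. *)
have : (- 'i) * comm_mean A O n K = 0.
  rewrite -[RHS]H /comm_mean -csphere_meanZ//; last exact: ctame_comm_integrand.
  apply: eq_csphere_mean => v _; rewrite coef1_mulX !p0 !p1 /comm_integrand.
  exact: comm_coef1_subproof.
by move=> /eqP; rewrite mulf_eq0 oppr_eq0 (negbTE (neq0Ci _)) => /eqP.
Qed.

End CommutatorMean.

(** * The moment recursion *)

Section HaarRecursion.
Local Open Scope sesquilinear_scope.
Context (R : realType) (d : nat) (mu : probability (CVec R d) R).
Hypothesis muH : haar_sphere_measure R d mu.
Implicit Types (A O K T B : 'M[R[i]]_d) (v : CVec R d).

Local Notation "<[ M ]> v" := (braket R d M v) (at level 10, v at level 9, format "<[ M ]>  v").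
Local Notation mean := (csphere_mean R d mu).
Local Notation comm_mean := (comm_mean R d mu).

Let involution_coef_subproof (F : comPzRingType) (t s : F) :
  t * s = - 2 -> t + (t + t * t * s) = 0.
Proof. by move=> ts; rewrite -mulrA ts; ring. Qed.

(** For [w] nonzero, the Householder reflection [1 - (2 / |w|^2) w w^*] is a Hermitian involution.
    Linearity and [comm_mean1] leave only the projector term, with a nonzero coefficient. *)
Lemma comm_mean_projector A O n (w : 'cV[R[i]]_d) : comm_mean A O n (w *m w ^t*) = 0.
Proof.
pose s := (w ^t* *m w) 0 0.
have ww : w ^t* *m w = s%:M by rewrite [LHS]mx11_scalar.
have sE : s = \sum_i `|w i 0| ^+ 2.
  by rewrite /s mxE; apply: eq_bigr => i _; rewrite !mxE normCK mulrC.
have s_ge0 : 0 <= s by rewrite sE sumr_ge0// => i _; rewrite exprn_ge0.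
have [s0|s_neq0] := eqVneq s 0.
  have -> : w = 0.
    apply/colP => i; rewrite mxE; apply/eqP; rewrite -normr_eq0 -sqrf_eq0.
    apply/eqP; apply: (@psumr_eq0P _ _ xpredT (fun i => `|w i 0| ^+ 2)) => //.
      by move=> j _; rewrite exprn_ge0.
    by rewrite -sE.
  by rewrite mul0mx -(scale0r 0) comm_meanZ// mul0r.
pose t := - (2 / s); pose P := w *m w ^t*; pose K : 'M_d := 1%:M + t *: P.
have ts : t * s = - 2 by rewrite /t mulNr divfK.
have tc : t^* = t by apply: CrealP; rewrite rpredN ger0_real// divr_ge0.
have PP : P *m P = s *: P.
  by rewrite /P mulmxA -(mulmxA w) ww mul_mx_scalar -scalemxAl.
have Kh : K ^t* = K by rewrite /K adjmxD adjmx1 adjmxZ adjmxM trmxCK tc.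
have K2 : K *m K = 1%:M.
  rewrite /K mulmxDl mul1mx -scalemxAl mulmxDr mulmx1 -scalemxAr PP scalerDr.
  rewrite !scalerA -!addrA -!scalerDl (involution_coef_subproof _ _ _ ts).
  by rewrite scale0r addr0.
have := comm_mean_involution R d mu muH A O K n Kh K2.
rewrite /K comm_meanD comm_meanZ comm_mean1// add0r => /eqP.
by rewrite mulf_eq0 oppr_eq0 mulf_eq0 invr_eq0 (negbTE s_neq0) pnatr_eq0 => /eqP.
Qed.

(** With [H1], [H2], [H3] the three left-hand sides, [H1 - H2] is [2 (b + c)] and
    [i (2 H3 - H1 - H2)] is [2 (b - c)]; together they give [4 b]. *)
Let polarization_subproof (F : numFieldType) (i a b c e : F) : i ^+ 2 = -1 ->
  a + 1 * b + 1 * c + e = 0 -> a + -1 * b + -1 * c + e = 0 ->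
  a + - i * b + i * c + e = 0 -> b = 0.
Proof.
move=> i2 H1 H2 H3; suff /eqP : 4 * b = 0 by rewrite mulf_eq0 pnatr_eq0 => /eqP.
transitivity ((a + 1 * b + 1 * c + e) - (a + -1 * b + -1 * c + e)
  + i * (2 * (a + - i * b + i * c + e) - (a + 1 * b + 1 * c + e)
  - (a + -1 * b + -1 * c + e))); last by rewrite H1 H2 H3; ring.
have -> : i * (2 * (a + - i * b + i * c + e) - (a + 1 * b + 1 * c + e)
  - (a + -1 * b + -1 * c + e)) = i ^+ 2 * (2 * (c - b)) by ring.
by rewrite i2; ring.
Qed.

Lemma comm_mean_dyad A O n (x y : 'cV[R[i]]_d) : comm_mean A O n (x *m y ^t*) = 0.
Proof.
have qD := comm_meanD R d mu A O n; have qZ := comm_meanZ R d mu A O n.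
have qP := comm_mean_projector A O n; move: (comm_mean A O n) qD qZ qP => q qD qZ qP.
(* The linear functional [q] vanishes on the projector of [x + z y]; this is used for
   [z = 1, -1, i]. *)
have H z : q (x *m x ^t*) + z^* * q (x *m y ^t*) + z * q (y *m x ^t*) +
    z * z^* * q (y *m y ^t*) = 0.
  rewrite -(qP (x + z *: y)) adjmxD adjmxZ.
  rewrite mulmxDl mulmxDr mulmxDr -!scalemxAl -!scalemxAr scalerA.
  by rewrite 3!qD 3!qZ !addrA.
have i2 : 'i * (- 'i) = 1 :> R[i] by rewrite mulrN -expr2 sqrCi opprK.
have H1 := H 1; have H2 := H (-1); have H3 := H 'i.
have N1c : (-1)^* = -1 :> R[i] by rewrite rmorphN1.
rewrite conjC1 !mul1r in H1; rewrite N1c mulrNN !mul1r in H2.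
rewrite conjCi i2 mul1r in H3.
apply: polarization_subproof (sqrCi _) _ _ H3.
  by rewrite !mul1r; exact: H1.
exact: H2.
Qed.

Let comm_sum_subproof (F : comPzRingType) (I J : finType) (a b c f g : I -> J -> F)
    (x z m S1 S2 S3 S4 : F) :
  \sum_i \sum_j a i j = S1 -> \sum_i \sum_j b i j = S2 ->
  \sum_i \sum_j c i j * f i j = S3 -> \sum_i \sum_j c i j * g i j = S4 ->
  \sum_i \sum_j ((a i j - b i j) * x + m * (c i j * (f i j - g i j) * z)) =
  (S1 - S2) * x + m * ((S3 - S4) * z).
Proof.
move=> <- <- <- <-; rewrite !pair_big /= -!sumrB !mulr_suml mulr_sumr -big_split.
by apply: eq_bigr => -[i j] _ /=; ring.
Qed.

Let comm_total_subproof (F : comPzRingType) (m n : nat) (b x t y : F) :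
  (m%:R * b - t) * x ^+ n + n%:R * ((x * b - y) * x ^+ n.-1) =
  (m + n)%:R * (b * x ^+ n) - t * x ^+ n - n%:R * (y * x ^+ n.-1).
(* For [n = 0] the default exponent [n.-1 = 0] is harmless, since the factor [n] kills the term. *)
Proof. by case: n => [|n]; rewrite ?exprS ?natrD /=; ring. Qed.

(** The four double sums contract to [d <B>], [tr B], [<O> <B>] and [<B O>]; the second and the
    fourth use [|v| = 1]. *)
Lemma sum_comm_integrand B O n v : unit_sphere R d v ->
  \sum_j \sum_k comm_integrand R d (delta_mx j k) O n (delta_mx k j *m B) v =
  (d + n)%:R * (<[B]> v * <[O]> v ^+ n) - \tr B * <[O]> v ^+ n
    - n%:R * (<[B *m O]> v * <[O]> v ^+ n.-1).
Proof.
move=> Sv; rewrite /comm_integrand.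
set u := v ^t*.
have bD j k (M : 'M_d) : <[delta_mx j k *m M]> v = u 0 j * (M *m v) k 0.
  by rewrite -[delta_mx _ _]mul1mx braket_delta mulmx1.
have bDr j k (M N : 'M_d) : <[M *m (delta_mx j k *m N)]> v = (u *m M) 0 j * (N *m v) k 0.
  by rewrite mulmxA braket_delta.
have uv : \sum_j u 0 j * v j 0 = 1 by have := Sv; rewrite /unit_sphere /= mxE.
have bE (M : 'M_d) : <[M]> v = \sum_j u 0 j * (M *m v) j 0.
  by rewrite /braket -mulmxA mxE.
have bE' (M : 'M_d) : <[M]> v = \sum_j (u *m M) 0 j * v j 0.
  by rewrite /braket mxE.
clearbody u.
have S1 : \sum_j \sum_(k < d) <[delta_mx j k *m (delta_mx k j *m B)]> v = d%:R * <[B]> v.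
  transitivity (\sum_j \sum_(k < d) u 0 j * (B *m v) j 0).
    by apply: eq_bigr => j _; apply: eq_bigr => k _; rewrite mulmxA mul_delta_mx bD.
  rewrite exchange_big /= sumr_const card_ord -[LHS]mulr_natl; congr (_ * _).
  by rewrite bE.
have S2 : \sum_j \sum_k <[delta_mx k j *m B *m delta_mx j k]> v = \tr B.
  transitivity (\sum_j \sum_k B j j * (u 0 k * v k 0)).
    apply: eq_bigr => j _; apply: eq_bigr => k _.
    rewrite -mulmxA bD -mulmxA mxE (bigD1 j)//= big1 => [|l lj].
      rewrite addr0 mulrCA; congr (_ * (_ * _)).
      rewrite mxE (bigD1 k)//= big1 => [|l lk]; first by rewrite mxE !eqxx mul1r addr0.
      by rewrite mxE (negbTE lk) andbF mul0r.
    by rewrite mxE big1 ?mulr0// => l' _; rewrite mxE (negbTE lj) mul0r.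
  by apply: eq_bigr => j _; rewrite -mulr_sumr uv mulr1.
have S3 : \sum_j \sum_k <[delta_mx j k]> v * <[O *m (delta_mx k j *m B)]> v = <[O]> v * <[B]> v.
  transitivity ((\sum_k (u *m O) 0 k * v k 0) * (\sum_j u 0 j * (B *m v) j 0)).
    rewrite mulrC mulr_suml; apply: eq_bigr => j _; rewrite mulr_sumr.
    apply: eq_bigr => k _; rewrite -[delta_mx j k]mulmx1 bD mul1mx bDr.
    by rewrite mulrACA [in RHS]mulrACA [_ * v k 0]mulrC.
  by rewrite -bE -bE'.
have S4 : \sum_j \sum_k <[delta_mx j k]> v * <[delta_mx k j *m B *m O]> v = <[B *m O]> v.
  transitivity ((\sum_k u 0 k * v k 0) * (\sum_j u 0 j * (B *m O *m v) j 0)).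
    rewrite mulrC mulr_suml; apply: eq_bigr => j _; rewrite mulr_sumr.
    apply: eq_bigr => k _; rewrite -[delta_mx j k]mulmx1 bD mul1mx -mulmxA bD.
    by rewrite mulrACA [in RHS]mulrACA [v k 0 * _]mulrC.
  by rewrite uv mul1r bE.
rewrite (comm_sum_subproof _ _ _ _ _ _ _ _ _ _ _ _ _ _ _ S1 S2 S3 S4).
exact: comm_total_subproof.
Qed.

(** Puts [E_kj B] in the form [x y^*] required by [comm_mean_dyad]. *)
Lemma delta_mulmx_dyad (j k : 'I_d) B :
  delta_mx k j *m B = delta_mx k 0 *m (B ^t* *m delta_mx j (0 : 'I_1)) ^t*.
Proof.
by rewrite adjmxM trmxCK trmx_delta map_delta_mx mulmxA mul_delta_mx.
Qed.

(** Every summand of [sum_comm_integrand] has mean zero. The case [n = 0] is [d E[<B>] = tr B],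
    which later normalises the POVM density. *)
Lemma mean_braketM_rec B O n :
  (d + n)%:R * mean (fun v => <[B]> v * <[O]> v ^+ n) =
  \tr B * mean (fun v => <[O]> v ^+ n) +
  n%:R * mean (fun v => <[B *m O]> v * <[O]> v ^+ n.-1).
Proof.
have tb M := ctame_braket R d M.
have tX m := ctameX R d _ m (tb O).
have tM M m := ctameM R d _ _ (tb M) (tX m).
have : mean (fun v => \sum_j \sum_k
    comm_integrand R d (delta_mx j k) O n (delta_mx k j *m B) v) = 0.
  rewrite csphere_mean_sum//; last first.
    by move=> j; apply: ctame_sum => k; exact: ctame_comm_integrand.
  apply: big1 => j _.
  rewrite csphere_mean_sum//; last by move=> k; exact: ctame_comm_integrand.
  by apply: big1 => k _; rewrite delta_mulmx_dyad; exact: comm_mean_dyad.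
rewrite (eq_csphere_mean _ _ _ _ _ (fun v Sv => sum_comm_integrand B O n v Sv)).
under eq_csphere_mean do rewrite -addrA -!mulNr.
rewrite csphere_meanD ?csphere_meanD ?csphere_meanZ//; try
  by repeat (apply: ctameM || apply: ctameD || apply: ctame_cst).
by move/eqP; rewrite addrA !mulNr !subr_eq add0r => /eqP ->; rewrite addrC.
Qed.

End HaarRecursion.

(** * Hilbert-Schmidt bounds *)

Section HilbertSchmidt.
Local Open Scope sesquilinear_scope.

(** Lagrange's identity: twice the gap is the sum of the squares of the real numbers
    [x i * y j - x j * y i]. *)
Lemma CauchySchwarz_sum (F : numFieldType) (I : finType) (x y : I -> F) :
  (forall i, 0 <= x i) -> (forall i, 0 <= y i) ->
  (\sum_i x i * y i) ^+ 2 <= (\sum_i x i ^+ 2) * (\sum_i y i ^+ 2).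
Proof.
move=> x0 y0.
have H : 0 <= \sum_i \sum_j (x i * y j - x j * y i) ^+ 2.
  apply: sumr_ge0 => i _; apply: sumr_ge0 => j _; rewrite -realEsqr.
  by rewrite rpredB// rpredM// ger0_real.
have E : \sum_i \sum_j (x i * y j - x j * y i) ^+ 2 =
    2 * ((\sum_i x i ^+ 2) * (\sum_i y i ^+ 2) - (\sum_i x i * y i) ^+ 2).
  rewrite expr2 [in RHS]big_distrlr [X in _ * (_ - X)]big_distrlr /=.
  transitivity (\sum_i \sum_j (x i ^+ 2 * y j ^+ 2 - x i * y i * (x j * y j)) +
     \sum_i \sum_j (x j ^+ 2 * y i ^+ 2 - x i * y i * (x j * y j))).
    rewrite -big_split; apply: eq_bigr => i _; rewrite -big_split.
    by apply: eq_bigr => j _ /=; ring.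
  rewrite [X in _ + X]exchange_big /= mulr_natl mulr2n; congr (_ + _).
    by rewrite -sumrB; apply: eq_bigr => i _; rewrite -sumrB.
  rewrite -sumrB; apply: eq_bigr => i _; rewrite -sumrB; apply: eq_bigr => j _.
  by rewrite [x j * y j * _]mulrC.
by move: H; rewrite E pmulr_rge0// subr_ge0.
Qed.

Context (C : numClosedFieldType).

Definition hs2 {m n} (M : 'M[C]_(m, n)) : C := \sum_i \sum_j `|M i j| ^+ 2.

(** The Hilbert-Schmidt norm as an element of [C], directly comparable with the [C]-valued modulus;
    [hs_normE] identifies it with [hs_norm]. *)
Definition hsn {m n} (M : 'M[C]_(m, n)) : C := sqrtC (hs2 M).

Lemma hs2_ge0 m n (M : 'M[C]_(m, n)) : 0 <= hs2 M.
Proof. by apply: sumr_ge0 => i _; apply: sumr_ge0 => j _; rewrite exprn_ge0. Qed.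

Lemma hsn_ge0 m n (M : 'M[C]_(m, n)) : 0 <= hsn M.
Proof. by rewrite sqrtC_ge0 hs2_ge0. Qed.

Lemma sqr_hsn m n (M : 'M[C]_(m, n)) : hsn M ^+ 2 = hs2 M.
Proof. by rewrite sqrtCK. Qed.

Lemma hs2E m n (M : 'M[C]_(m, n)) : hs2 M = \tr (M ^t* *m M).
Proof.
rewrite /hs2 exchange_big; apply: eq_bigr => j _; rewrite mxE.
by apply: eq_bigr => i _; rewrite !mxE normCK mulrC.
Qed.

Lemma norm_sum_CauchySchwarz (I : finType) (a b : I -> C) :
  `|\sum_i a i * b i| ^+ 2 <= (\sum_i `|a i| ^+ 2) * (\sum_i `|b i| ^+ 2).
Proof.
apply: le_trans (CauchySchwarz_sum _ _ (fun i => `|a i|) (fun i => `|b i|) _ _) => //.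
rewrite ler_pXn2r ?nnegrE ?sumr_ge0//; last by move=> i _; rewrite mulr_ge0.
apply: le_trans (ler_norm_sum _ _ _) _.
by under eq_bigr do rewrite normrM.
Qed.

Lemma norm_mxtrace_mulmx m n (B : 'M[C]_(m, n)) (M : 'M[C]_(n, m)) :
  `|\tr (B *m M)| <= hsn B * hsn M.
Proof.
rewrite -(@ler_pXn2r _ 2) ?nnegrE ?mulr_ge0 ?hsn_ge0// exprMn !sqr_hsn.
rewrite /hs2 [X in _ <= _ * X]exchange_big !pair_big /=.
have -> : \tr (B *m M) = \sum_p B p.1 p.2 * M p.2 p.1.
  rewrite -(pair_big xpredT xpredT (fun i j => B i j * M j i)).
  by apply: eq_bigr => i _; rewrite mxE.
exact: norm_sum_CauchySchwarz.
Qed.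

Lemma hsnM m n p (B : 'M[C]_(m, n)) (M : 'M[C]_(n, p)) :
  hsn (B *m M) <= hsn B * hsn M.
Proof.
rewrite -(@ler_pXn2r _ 2) ?nnegrE ?mulr_ge0 ?hsn_ge0// exprMn !sqr_hsn.
rewrite /hs2 [X in _ <= _ * X]exchange_big big_distrlr /=.
apply: ler_sum => i _; apply: ler_sum => k _; rewrite mxE.
exact: norm_sum_CauchySchwarz.
Qed.

End HilbertSchmidt.
Arguments hs2 {C m n}.
Arguments hsn {C m n}.

(** * Moment bounds for a traceless observable *)

Section HaarBound.
Context (R : realType) (d : nat) (mu : probability (CVec R d) R).
Hypotheses (muH : haar_sphere_measure R d mu) (d_gt0 : (0 < d)%N).
Context (O : 'M[R[i]]_d).
Hypothesis trO : \tr O = 0.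

Local Notation "<[ M ]> v" := (braket R d M v) (at level 10, v at level 9, format "<[ M ]>  v").
Local Notation mean := (csphere_mean R d mu).

(* [h n] is the complete homogeneous symmetric polynomial of degree [n] in the
   eigenvalues of [O]; [aS] and [hS] are Newton's identities for it. *)
Let h n : R[i] := 'C(d.-1 + n, n)%:R * mean (fun v => <[O]> v ^+ n).
Let a B n : R[i] := 'C(d + n, n)%:R * (d%:R * mean (fun v => <[B]> v * <[O]> v ^+ n)).

Let h0 : h 0 = 1.
Proof. by rewrite /h bin0 mul1r csphere_mean_cst. Qed.

Let a0 B : a B 0 = \tr B.
Proof.
rewrite /a bin0 mul1r; have := mean_braketM_rec R d mu muH B O 0.
by rewrite addn0 mul0r addr0 csphere_mean_cst// mulr1.
Qed.

Let aS B n : a B n.+1 = \tr B * h n.+1 + a (B *m O) n.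
Proof.
rewrite /a /h; have := mean_braketM_rec R d mu muH B O n.+1; rewrite [n.+1.-1]/=.
move: (mean _) (mean _) (mean _) => x y z H.
(* [E1] and [E2] absorb the factors [d + n + 1] and [n + 1] of the recursion into the binomial
   normalisations. *)
have E1 : ('C(d + n.+1, n.+1) * d = (d + n.+1) * 'C(d.-1 + n.+1, n.+1))%N.
  have := mul_bin_down (d + n.+1) n.+1; rewrite addnK [RHS]mulnC => <-.
  by congr (_ * 'C(_, _))%N; rewrite -[in LHS](prednK d_gt0).
have E2 : ('C(d.-1 + n.+1, n.+1) * n.+1 = 'C(d + n, n) * d)%N.
  have := mul_bin_left (d + n) n; rewrite addnK [RHS]mulnC => <-.
  by rewrite mulnC addnS -addSn prednK.
rewrite mulrA -natrM E1 natrM [_%:R * _%:R]mulrC -mulrA H mulrDr mulrA.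
rewrite [_ * \tr B]mulrC -mulrA; congr (_ + _).
by rewrite !mulrA -!natrM E2.
Qed.

Let hS n : n.+1%:R * h n.+1 = a O n.
Proof.
rewrite /a /h; under eq_csphere_mean do rewrite exprS.
move: (mean _) => x; rewrite !mulrA -!natrM; congr (_%:R * _).
have := mul_bin_left (d + n) n; rewrite addnK [RHS]mulnC => <-.
by rewrite addnS -addSn prednK.
Qed.

Local Notation s := (hsn O).

Let s_ge0 : 0 <= s. Proof. exact: hsn_ge0. Qed.

(** Unfolding [aS] gives [n + 1] terms [tr (B O^(k+1)) h_(n-k)], each at most [|B| s^(n+1)]. The
    factor [O] beside [B] matters: [|tr (B O)| <= |B| s] is dimension-free, whereas [tr B] alone is
    not controlled by [|B|] without a factor [sqrt d]. *)
Let a_bound n B : (forall m, (m <= n)%N -> `|h m| <= s ^+ m) ->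
  `|a (B *m O) n| <= n.+1%:R * (hsn B * s ^+ n.+1).
Proof.
elim: n B => [|n ih] B hh.
  by rewrite a0 mul1r norm_mxtrace_mulmx.
rewrite aS; apply: le_trans (ler_normD _ _) _.
rewrite -[n.+2%:R]natr1 addrC mulrDl mul1r lerD//.
  apply: le_trans (ih _ _) _ => [m mn|]; first by rewrite hh// leqW.
  rewrite ler_wpM2l// [s ^+ n.+2]exprS mulrA ler_wpM2r ?exprn_ge0//.
  exact: hsnM.
rewrite normrM [s ^+ n.+2]exprS mulrA ler_pM// ?norm_mxtrace_mulmx//.
exact: hh.
Qed.

(** Strong induction on Newton's identity [hS]: since [tr O = 0] the first term of [aS] disappears,
    and [a_bound] applies to what is left. *)
Let h_bound n : `|h n| <= s ^+ n.
Proof.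
elim/ltn_ind: n => -[|n] ih; first by rewrite h0 normr1.
rewrite -(@ler_pM2l _ n.+1%:R) ?ltr0n// -[n.+1%:R in leLHS]normr_nat -normrM hS.
case: n ih => [|n] ih.
  by rewrite a0 trO normr0 mulr_ge0 ?exprn_ge0.
rewrite aS trO mul0r add0r; apply: le_trans (a_bound _ _ _) _ => [m mn|].
  by apply: ih; rewrite ltnS leqW.
by rewrite -exprS ler_wpM2r ?exprn_ge0// ler_nat.
Qed.

Lemma haar_moment_bound (rho : 'M[R[i]]_d) n : \tr rho = 1 -> hsn rho <= 1 ->
  'C(d + n, n)%:R * `|d%:R * mean (fun v => <[rho]> v * <[O]> v ^+ n)| <=
  n.+1%:R * s ^+ n.
Proof.
move=> tr1 rho1; rewrite -[_%:R in leLHS]normr_nat -normrM -/(a rho n).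
case: n => [|n]; first by rewrite a0 tr1 normr1 mul1r.
(* The trace term contributes one [s^(n+1)], and [a (rho O) n] contributes [n + 1] more. *)
rewrite aS tr1 mul1r; apply: le_trans (ler_normD _ _) _.
rewrite -[n.+2%:R]natr1 addrC mulrDl mul1r lerD//.
apply: le_trans (a_bound _ _ (fun m _ => h_bound m)) _.
by rewrite ler_wpM2l// ler_piMl ?exprn_ge0.
Qed.

End HaarBound.

(** * Quantum states *)

Section QuantumState.
Local Open Scope sesquilinear_scope.
Context (R : realType) (d : nat).

Let braket_pair_subproof (F : comPzRingType) (x x' y y' a b c e : F) :
  x' * x * a + y' * x * c + (x' * y * b + y' * y * e) =
  x' * x * a + x' * y * b + y' * x * c + y' * y * e.
Proof. by ring. Qed.

Let quantum_entry_subproof (F : numDomainType) (a b r r' : F) :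
  0 <= - r' * - r * a + - r' * a * r + a * - r * r' + a * a * b ->
  a * (r * r') <= a * (a * b).
Proof.
by move=> H; rewrite -subr_ge0 (_ : _ - _ = - r' * - r * a + - r' * a * r +
  a * - r * r' + a * a * b)//; ring.
Qed.

Let quantum_zero_subproof (F : numDomainType) (r r' : F) :
  0 <= - r' * 1 * r + 1 * - r * r' -> r * r' <= 0.
Proof.
rewrite (_ : _ + _ = - (r * r') * 2); last by ring.
by rewrite pmulr_lge0// oppr_ge0.
Qed.

Lemma mulmx_delta_entry (M : 'M[R[i]]_d) i j :
  (delta_mx i (0 : 'I_1)) ^t* *m M *m delta_mx j (0 : 'I_1) = (M i j)%:M.
Proof.
rewrite trmx_delta map_delta_mx -rowE -colE [LHS]mx11_scalar.
by rewrite !mxE.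
Qed.

Lemma braket_pair (M : 'M[R[i]]_d) i j (x y : R[i]) :
  braket R d M (x *: delta_mx i 0 + y *: delta_mx j 0) =
  x^* * x * M i i + x^* * y * M i j + y^* * x * M j i + y^* * y * M j j.
Proof.
have T a b (k l : 'I_d) :
    ((a *: delta_mx k (0 : 'I_1)) ^t* *m M *m (b *: delta_mx l (0 : 'I_1))) 0 0 =
    a^* * b * M k l.
  rewrite adjmxZ -scalemxAr -scalemxAl -scalemxAl mulmx_delta_entry scalerA.
  by rewrite !mxE eqxx mulr1n [b * _]mulrC.
have addE (P Q : 'M[R[i]]_1) : (P + Q) 0 0 = P 0 0 + Q 0 0 by rewrite mxE.
rewrite /braket adjmxD mulmxDr 2!mulmxDl mulmxDl 3!addE 4!T.
exact: braket_pair_subproof.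
Qed.

(** Positivity of the two-by-two principal minors, obtained from explicit test vectors. *)
Lemma quantum_state_entry (rho : 'M[R[i]]_d) i j : quantum_state R d rho ->
  `|rho i j| ^+ 2 <= rho i i * rho j j.
Proof.
move=> [rhoh [rho_ge0 _]].
have conj_rho k l : rho l k = (rho k l)^* by rewrite -[in LHS]rhoh !mxE.
have pair k l x y := rho_ge0 (x *: delta_mx k 0 + y *: delta_mx l 0).
have diag k : 0 <= rho k k.
  by have := pair k k 1 0; rewrite braket_pair conjC1 conjC0 !mul0r !mulr0 !mul0r !mul1r !addr0.
(* The vector [- rho_kl e_k + rho_kk e_l] has quadratic form [rho_kk] times the minor. *)
have key k l : rho k k * `|rho k l| ^+ 2 <= rho k k * (rho k k * rho l l).
  have := pair k l (- rho k l) (rho k k).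
  rewrite braket_pair rmorphN /= (geC0_conj (diag k)) [rho l k]conj_rho.
  by rewrite normCK => /quantum_entry_subproof.
have [a0|a_neq0] := eqVneq (rho i i) 0; last first.
  by rewrite -(ler_pM2l (_ : 0 < rho i i)) ?key// lt_def a_neq0 diag.
have [b0|b_neq0] := eqVneq (rho j j) 0; last first.
  rewrite mulrC -(ler_pM2l (_ : 0 < rho j j)) ?lt_def ?b_neq0 ?diag//.
  by rewrite -norm_conjC -conj_rho key.
(* Both diagonal entries vanish here; the form at [- rho_ij e_i + e_j] is [-2 |rho_ij|^2], which
   forces [rho_ij = 0]. *)
have := pair i j (- rho i j) 1; rewrite braket_pair a0 b0 conjC1 [rho j i]conj_rho rmorphN /=.
rewrite normCK !mulr0 add0r addr0 => /quantum_zero_subproof.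
by rewrite -a0.
Qed.

Lemma quantum_state_hsn (rho : 'M[R[i]]_d) : quantum_state R d rho -> hsn rho <= 1.
Proof.
move=> hrho; rewrite -(@ler_pXn2r _ 2) ?nnegrE ?hsn_ge0// sqr_hsn expr1n.
have [_ [_ tr1]] := hrho; rewrite -(mulr1 1) -tr1 /mxtrace big_distrlr /=.
by apply: ler_sum => i _; apply: ler_sum => j _; exact: quantum_state_entry.
Qed.

Lemma quantum_state_dim_gt0 (rho : 'M[R[i]]_d) : quantum_state R d rho -> (0 < d)%N.
Proof.
move=> [_ [_]]; case: (posnP d) rho => [-> rho|//].
by rewrite /mxtrace big_ord0 => /eqP; rewrite eq_sym oner_eq0.
Qed.

Lemma hs_normE (M : 'M[R[i]]_d) : (hs_norm R d M)%:C%C = hsn M.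
Proof.
apply/eqP; rewrite -(@eqrXn2 _ 2) ?hsn_ge0 ?ler0c ?sqrtr_ge0// sqr_hsn hs2E.
have := hs2_ge0 _ _ _ M; rewrite hs2E => tr_ge0.
have -> : (hs_norm R d M)%:C%C ^+ 2 = (hs_norm R d M ^+ 2)%:C%C by rewrite rmorphXn.
rewrite /hs_norm sqr_sqrtr; first by rewrite RRe_real// ger0_real.
by move: tr_ge0; rewrite lecE => /andP[].
Qed.

End QuantumState.

(** * Expectations under the POVM distribution *)

Lemma fact_leq_expn n : (n`! <= n ^ n)%N.
Proof.
elim: n => // n ih; rewrite factS expnS leq_mul2l /=.
by apply: leq_trans ih _; case: n => // n; rewrite leq_exp2r.
Qed.

(** [C(d+n, n) n!] is the product of [d+1, ..., d+n]. This trades the binomial of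
    [haar_moment_bound] for a power of [d + 1], at the cost of [n^n]. *)
Lemma expn_leq_bin d n : (d.+1 ^ n <= 'C(d + n, n) * n ^ n)%N.
Proof.
apply: (@leq_trans ('C(d + n, n) * n`!)); last by rewrite leq_mul2l fact_leq_expn orbT.
rewrite bin_ffact; elim: n => // n ih.
by rewrite addnS ffactnS expnS leq_mul// ltnS leq_addr.
Qed.

Lemma normc_real (R : realType) (x : R) : `|x%:C%C| = (`|x|)%:C%C :> R[i].
Proof. by rewrite normc_def /= expr0n addr0 sqrtr_sqr. Qed.

Section Assembly.
Context (R : realType) (d : nat) (mu : probability (CVec R d) R) (rho : 'M[R[i]]_d).
Hypotheses (muH : haar_sphere_measure R d mu) (rhoH : quantum_state R d rho).
Implicit Types f g : CVec R d -> R.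
Local Notation S := (unit_sphere R d).

Let W (v : CVec R d) : R := d%:R * complex.Re (braket R d rho v).

Let tame_Re_braket M : tame R d (fun v => complex.Re (braket R d M v)).
Proof. by have [] := ctame_braket R d M. Qed.

Let tW : tame R d W.
Proof. by apply: tameM; [exact: tame_cst | exact: tame_Re_braket]. Qed.

Let W_ge0 v : 0 <= W v.
Proof.
apply: mulr_ge0 => //; have [_ [/(_ v) + _]] := rhoH.
by rewrite lecE => /andP[].
Qed.

(** Real-valued form of [povm_expect], taken over the sphere; [povm_expectE] identifies the two on
    tame functions. *)
Definition povm_mean f : R := sphere_mean R d mu (fun v => f v * W v).

Lemma povm_expectE f : tame R d f -> povm_expect R d mu rho f = (povm_mean f)%:E.
Proof. by move=> tf; apply: (integral_sphere R d mu muH); exact: tameM. Qed.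

Lemma eq_povm_mean f g : (forall v, S v -> f v = g v) -> povm_mean f = povm_mean g.
Proof. by move=> fg; apply: eq_sphere_mean => v Sv; rewrite fg. Qed.

Lemma le_povm_mean f g : tame R d f -> tame R d g ->
  (forall v, S v -> f v <= g v) -> povm_mean f <= povm_mean g.
Proof.
move=> tf tg fg; apply: le_sphere_mean; try exact: tameM.
by move=> v Sv; rewrite ler_wpM2r// fg.
Qed.

Lemma povm_meanD f g : tame R d f -> tame R d g ->
  povm_mean (fun v => f v + g v) = povm_mean f + povm_mean g.
Proof.
move=> tf tg; rewrite /povm_mean; under eq_sphere_mean do rewrite mulrDl.
by apply: sphere_meanD; exact: tameM.
Qed.

Lemma povm_meanZ c f : tame R d f ->
  povm_mean (fun v => c * f v) = c * povm_mean f.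
Proof.
move=> tf; rewrite /povm_mean; under eq_sphere_mean do rewrite -mulrA.
by apply: sphere_meanZ; exact: tameM.
Qed.

Lemma csphere_mean_real f :
  csphere_mean R d mu (fun v => (f v)%:C%C) = (sphere_mean R d mu f)%:C%C.
Proof. by congr Complex; exact: sphere_mean_cst. Qed.

Lemma povm_mean_moment (O : 'M[R[i]]_d) n : hermitian_mx R d O ->
  (povm_mean (fun v => complex.Re (braket R d O v) ^+ n))%:C%C =
  d%:R * csphere_mean R d mu (fun v => braket R d rho v * braket R d O v ^+ n).
Proof.
move=> hO; have tb M := ctame_braket R d M.
rewrite -csphere_meanZ; last by apply: ctameM => //; exact: ctameX.
rewrite /povm_mean -csphere_mean_real; apply: eq_csphere_mean => v _.
rewrite (braket_herm_real R d O v hO) (braket_herm_real R d rho v rhoH.1).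
rewrite /W /= -rmorphXn -rmorphM -(rmorph_nat (real_complex R)) -rmorphM.
by rewrite mulrC mulrA.
Qed.

Lemma povm_mean_cst c : povm_mean (fun=> c) = c.
Proof.
rewrite -[c in LHS]mulr1 (povm_meanZ c (fun=> 1)); last exact: tame_cst.
rewrite -[RHS]mulr1; congr (_ * _); apply: (@complexI R).
(* The total mass is a zeroth moment, for which any Hermitian observable serves; [rho] itself is
   taken. *)
rewrite (povm_mean_moment rho 0 rhoH.1).
have := mean_braketM_rec R d mu muH rho rho 0; rewrite addn0 => ->.
by rewrite rhoH.2.2 mul0r addr0 mul1r csphere_mean_cst.
Qed.

Lemma povm_mean_moment_bound (O : 'M[R[i]]_d) n : hermitian_mx R d O -> \tr O = 0 ->
  `|povm_mean (fun v => complex.Re (braket R d O v) ^+ n)| <=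
  n.+1%:R * (n%:R * (hs_norm R d O / (d%:R + 1))) ^+ n.
Proof.
move=> hO tr0.
have := haar_moment_bound R d mu muH (quantum_state_dim_gt0 R d rho rhoH) O tr0
  rho n rhoH.2.2 (quantum_state_hsn R d rho rhoH).
rewrite -povm_mean_moment// -hs_normE normc_real -rmorphXn.
rewrite -!(rmorph_nat (real_complex R)) -!rmorphM lecR.
set x := `|_|; set s := hs_norm R d O => H.
have d1_gt0 : 0 < (d%:R + 1) ^+ n :> R by rewrite exprn_gt0// ltr_wpDl.
rewrite exprMn expr_div_n mulrA mulrA ler_pdivlMr//.
apply: (@le_trans _ _ (x * ('C(d + n, n) * n ^ n)%:R)).
  rewrite ler_wpM2l ?normr_ge0//.
  by rewrite natr1 -natrX ler_nat expn_leq_bin.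
rewrite natrM mulrA natrX [leRHS]mulrAC ler_wpM2r ?exprn_ge0//.
by rewrite mulrC.
Qed.

End Assembly.

(** * Elementary inequalities for powers *)

Lemma sqr_sub_le (R : realDomainType) (x y : R) k :
  (x - y) ^+ (2 * k) <= 4 ^+ k * (x ^+ (2 * k) + y ^+ (2 * k)).
Proof.
rewrite !exprM mulrDr -!exprMn.
have H : (x - y) ^+ 2 <= 2 * x ^+ 2 + 2 * y ^+ 2.
  by have := sqr_ge0 (x + y); nra.
have x2 := sqr_ge0 x; have y2 := sqr_ge0 y.
have [xy|yx] := leP (x ^+ 2) (y ^+ 2).
  apply: le_trans (_ : (4 * y ^+ 2) ^+ k <= _); last by rewrite lerDr exprn_ge0// mulr_ge0.
  by apply: lerXn2r; rewrite ?nnegrE ?sqr_ge0//; lra.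
apply: le_trans (_ : (4 * x ^+ 2) ^+ k <= _); last by rewrite lerDl exprn_ge0// mulr_ge0.
by apply: lerXn2r; rewrite ?nnegrE ?sqr_ge0//; lra.
Qed.

(** The difference of the two sides is [(y - t)^2 y^(2k)]; the sign of [y] is free, so odd moments
    need no absolute values. *)
Lemma odd_pow_le (R : realDomainType) (y t : R) k :
  2 * t * y ^+ (2 * k).+1 <= y ^+ (2 * k.+1) + t ^+ 2 * y ^+ (2 * k).
Proof.
have -> : (2 * k.+1 = (2 * k).+2)%N by rewrite mulnS.
rewrite -subr_ge0 (_ : _ - _ = (y - t) ^+ 2 * (y ^+ k) ^+ 2).
  by rewrite mulr_ge0 ?sqr_ge0.
rewrite [(2 * k)%N]mulnC !exprS exprM; ring.
Qed.

(** * Removing the trace of the observable *)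

Section Traceless.
Local Open Scope sesquilinear_scope.
Context (R : realType) (d : nat) (O : 'M[R[i]]_d).
Hypotheses (hO : hermitian_mx R d O) (d_gt0 : (0 < d)%N).

Let c : R := complex.Re (\tr O) / d%:R.

(** Subtracting a real multiple of the identity shifts [<O>] by a constant on the sphere, so central
    moments do not change. *)
Definition traceless : 'M[R[i]]_d := O + (- c%:C%C) *: 1%:M.

Let traceless_subproof (F : numDomainType) (x n t : F) : 0 <= n * t ^+ 2 ->
  x + - t * (n * t) + (- t * (n * t) + - t * (- t * n)) <= x.
Proof.
move=> H; rewrite (_ : _ + _ = x - n * t ^+ 2); last by ring.
by rewrite lerBlDr lerDl.
Qed.

Let dc : \tr O = d%:R * c%:C%C.
Proof.
have tr_real : \tr O = (complex.Re (\tr O))%:C%C.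
  rewrite RRe_real//; apply/CrealP; rewrite -[in RHS]hO /mxtrace rmorph_sum.
  by apply: eq_bigr => i _; rewrite !mxE.
have -> : c%:C%C = \tr O / d%:R by rewrite [in RHS]tr_real fmorph_div /= rmorph_nat.
by rewrite mulrC divfK// pnatr_eq0 lt0n_neq0.
Qed.

Lemma traceless_hermitian : hermitian_mx R d traceless.
Proof.
rewrite /hermitian_mx /traceless adjmxD adjmxZ adjmx1 hO; congr (_ + _ *: _).
by apply: CrealP; rewrite rpredN; apply/complex_realP; exists c.
Qed.

Lemma mxtrace_traceless : \tr traceless = 0.
Proof. by rewrite /traceless mxtraceD mxtraceZ mxtrace1 dc mulNr mulrC subrr. Qed.

(** Expanding the square gives [|O|^2 - d c^2]. *)
Lemma hs_norm_traceless : hs_norm R d traceless <= hs_norm R d O.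
Proof.
rewrite -lecR !hs_normE ler_sqrtC ?qualifE ?/= ?hs2_ge0// !hs2E.
have -> : traceless ^t* = traceless by exact: traceless_hermitian.
have -> : O ^t* = O by exact: hO.
rewrite /traceless mulmxDl mulmxDr -!scalemxAl mul1mx -scalemxAr mulmx1.
rewrite scalerDr !mxtraceD !mxtraceZ mxtrace1 dc.
have : 0 <= d%:R * c%:C%C ^+ 2 :> R[i].
  by rewrite mulr_ge0// -rmorphXn ler0c sqr_ge0.
exact: traceless_subproof.
Qed.

Lemma Re_braket_traceless v : unit_sphere R d v ->
  complex.Re (braket R d O v) = complex.Re (braket R d traceless v) + c.
Proof.
move=> Sv; rewrite /traceless braketD braketZ braket1// mulr1 raddfD /=.
by rewrite subrK.
Qed.

End Traceless.

Lemma add2n_le_expn n : (2 <= n)%N -> (n.+2 <= 2 ^ n)%N.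
Proof.
elim: n => // n ih; rewrite ltnS leq_eqVlt => /predU1P[<-//|/ih].
by rewrite expnS; lia.
Qed.

(** * Central moments *)

Section CentralMoments.
Context (R : realType) (d : nat) (mu : probability (CVec R d) R) (rho : 'M[R[i]]_d).
Hypotheses (muH : haar_sphere_measure R d mu) (rhoH : quantum_state R d rho).
Context (X : CVec R d -> R) (tau : R).
Hypotheses (tX : tame R d X) (tau_ge0 : 0 <= tau).

Local Notation mean := (povm_mean R d mu rho).

Hypothesis moment : forall n, `|mean (fun v => X v ^+ n)| <= n.+1%:R * (n%:R * tau) ^+ n.

Let m := mean X.

Let tXm n : tame R d (fun v => (X v - m) ^+ n).
Proof. by apply: tameX; apply: tameD => //; exact: tame_cst. Qed.

Lemma even_central_moment k : (0 < k)%N ->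
  mean (fun v => (X v - m) ^+ (2 * k)) <= (4 * ((2 * k)%:R * tau)) ^+ (2 * k).
Proof.
move=> k_gt0; set n := (2 * k)%N.
have n_ge2 : (2 <= n)%N by rewrite /n leq_pmulr.
(* The first moment gives [|m| <= 2 tau], and [n >= 2]. *)
have m_le : m ^+ n <= (n%:R * tau) ^+ n.
  rewrite -[m ^+ n]ger0_norm; last by rewrite /n exprM exprn_ge0// sqr_ge0.
  rewrite normrX lerXn2r ?nnegrE ?mulr_ge0//.
  have := moment 1; under eq_povm_mean do rewrite expr1.
  rewrite expr1 mul1r => /le_trans; apply.
  by rewrite ler_wpM2r// ler_nat.
apply: le_trans (_ : 4 ^+ k * (mean (fun v => X v ^+ n) + m ^+ n) <= _).
  rewrite -[m ^+ n in leRHS](povm_mean_cst R d mu rho muH rhoH).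
  rewrite -povm_meanD; [|exact: tameX|exact: tame_cst].
  rewrite -povm_meanZ; last by apply: tameD; [exact: tameX | exact: tame_cst].
  apply: le_povm_mean => // [|v _]; last exact: sqr_sub_le.
  apply: tameM; first exact: tame_cst.
  by apply: tameD; [exact: tameX | exact: tame_cst].
(* The constant 4 is a product of two factors 2: one from [4^k = 2^n], the other from
   [n + 2 <= 2^n], which absorbs the [n + 1] of the moment bound and the 1 from [m^n]. *)
have -> : (4 : R) = 2 ^+ 2 by rewrite -natrX.
rewrite -exprM -/n [leRHS]exprMn -exprM [(2 * n)%N]mulSn mul1n exprD -mulrA.
rewrite ler_wpM2l ?exprn_ge0//.
apply: le_trans (_ : (n.+2%:R * (n%:R * tau) ^+ n) <= _).
  rewrite -[n.+2%:R]natr1 mulrDl mul1r lerD//.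
  by apply: le_trans (ler_norm _) (moment n).
rewrite ler_wpM2r ?exprn_ge0 ?mulr_ge0// -natrX ler_nat.
exact: add2n_le_expn.
Qed.

Lemma central_moment h : (2 <= h)%N ->
  mean (fun v => (X v - m) ^+ h) <= (8 * (h%:R * tau)) ^+ h.
Proof.
move=> h_ge2; set t := 8 * (h%:R * tau).
have t_ge0 : 0 <= t by rewrite !mulr_ge0.
(* The constant doubles to 8 so that the same [t] also serves the exponent [h + 1]:
   [4 (h + 1) <= 8 h]. *)
have even_le k : (0 < k)%N -> (2 * k <= h.+1)%N ->
    mean (fun v => (X v - m) ^+ (2 * k)) <= t ^+ (2 * k).
  move=> k0 kh; apply: le_trans (even_central_moment k k0) _.
  apply: lerXn2r; rewrite ?nnegrE ?mulr_ge0// /t !mulrA ler_wpM2r// -!natrM ler_nat.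
  by lia.
pose k := h./2; have k_gt0 : (0 < k)%N by rewrite half_gt0.
have := odd_double_half h; rewrite -muln2 mulnC -/k; case: (odd h) => /= hk; last first.
  by move: hk (even_le k k_gt0); rewrite add0n => ->; apply.
rewrite add1n in hk.
have E1 : mean (fun v => (X v - m) ^+ (2 * k)) <= t ^+ (2 * k).
  by apply: even_le => //; lia.
have E2 : mean (fun v => (X v - m) ^+ (2 * k.+1)) <= t ^+ (2 * k.+1).
  by apply: even_le => //; lia.
have H u : 2 * u * mean (fun v => (X v - m) ^+ h) <= t ^+ (2 * k.+1) + u ^+ 2 * t ^+ (2 * k).
  apply: le_trans (lerD E2 (ler_wpM2l (sqr_ge0 u) E1)).
  rewrite -!povm_meanZ// -povm_meanD//; last by apply: tameM => //; exact: tame_cst.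
  apply: (le_povm_mean R d mu rho rhoH) => [||v _].
  - by apply: tameM => //; exact: tame_cst.
  - by apply: tameD => //; apply: tameM => //; exact: tame_cst.
  - by rewrite -hk; exact: odd_pow_le.
(* The optimal choice [u = t] requires dividing by [t]; when [t = 0] both even moments are bounded
   by 0 and [u = 1] concludes. *)
have [t0|t_neq0] := eqVneq t 0.
  have k0 : (k == 0)%N = false by rewrite eqn0Ngt k_gt0.
  have h0 : (h == 0)%N = false by rewrite eqn0Ngt (ltnW h_ge2).
  have := H 1; rewrite t0 !expr0n !muln_eq0 k0 h0 /= mulr0 addr0 mulr1.
  by rewrite pmulr_rle0.
have t_gt0 : 0 < 2 * t by rewrite mulr_gt0// lt_def t_neq0.
rewrite -(ler_pM2l t_gt0); apply: le_trans (H t) _.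
by rewrite -hk mulnS !exprS; lra.
Qed.

End CentralMoments.

(** * From the traceless part to an arbitrary Hermitian observable *)

Theorem theorem6 (R : realType) :
  exists C : R,
  forall (d : nat) (mu : probability (CVec R d) R) (rho : 'M[R[i]]_d),
    haar_sphere_measure R d mu ->
    quantum_state R d rho ->
  forall (h : nat) (O : 'M[R[i]]_d),
    (2 <= h)%N ->
    hermitian_mx R d O ->
    let mean := fine (povm_expect R d mu rho
                        (fun v => complex.Re (braket R d O v))) in
    (povm_expect R d mu rho
       (fun v => ((complex.Re (braket R d O v) - mean) ^+ h)%R)
     <= ((C * h%:R * hs_norm R d O / (d%:R + 1)) ^+ h)%:E)%E.
Proof.
(* The constant is the 8 of [central_moment]. *)
exists 8 => d mu rho muH rhoH h O h_ge2 hO; lazy zeta; set mean := fine _.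
have d_gt0 := quantum_state_dim_gt0 R d rho rhoH.
have tRe M : tame R d (fun v => complex.Re (braket R d M v)).
  by have [] := ctame_braket R d M.
pose X v := complex.Re (braket R d (traceless R d O) v).
pose tau := hs_norm R d (traceless R d O) / (d%:R + 1).
have tau_ge0 : 0 <= tau by rewrite divr_ge0 ?sqrtr_ge0 ?addr_ge0.
have moment n := povm_mean_moment_bound R d mu rho muH rhoH _ n
  (traceless_hermitian R d O hO) (mxtrace_traceless R d O hO d_gt0).
pose c := complex.Re (\tr O) / d%:R.
have meanE : mean = povm_mean R d mu rho X + c.
  rewrite /mean povm_expectE//= -[in RHS](povm_mean_cst R d mu rho muH rhoH c).
  rewrite -povm_meanD//; [|exact: tRe|exact: tame_cst].
  by apply: eq_povm_mean => v Sv; exact: Re_braket_traceless.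
rewrite povm_expectE//; last first.
  by apply: tameX; apply: tameD => //; exact: tame_cst.
rewrite lee_fin.
(* The shift [c] occurs both in [<O>] and in its mean, and cancels. *)
under eq_povm_mean => v Sv.
  rewrite meanE (Re_braket_traceless R d O v Sv) opprD addrACA subrr addr0 -/(X v).
  over.
apply: le_trans (central_moment R d mu rho muH rhoH X tau (tRe _) tau_ge0 moment h h_ge2) _.
apply: lerXn2r; rewrite ?nnegrE.
- by apply: mulr_ge0 => //; apply: mulr_ge0.
- by rewrite divr_ge0 ?mulr_ge0 ?sqrtr_ge0 ?addr_ge0.
rewrite -!mulrA ler_wpM2l// ler_wpM2l// ler_wpM2r ?invr_ge0 ?addr_ge0//.
exact: hs_norm_traceless.
Qed.
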